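(* Let $n\ge0$ be an integer and let $\mathbf a,\mathbf b\in\{0,1\}^n\cup\{\pm1\}^n$. Then the following are equivalent: (i) $\mathbf a=\mathbf b$; (ii) $\mathcal T_{\mathbf a}$ and $\mathcal T_{\mathbf b}$ are isomorphic; (iii) $\mathsf E(\mathcal T_{\mathbf a},x,y)=\mathsf E(\mathcal T_{\mathbf b},x,y)$ and $\mathsf O(\mathcal T_{\mathbf a},x,y)=\mathsf O(\mathcal T_{\mathbf b},x,y)$; (iv) $\mathsf E(\mathcal T_{\mathbf a},x,y)=\mathsf E(\mathcal T_{\mathbf b},x,y)$.
   Context: A signed graph $\Sigma=(\Gamma,\sigma)$ is a finite simple graph $\Gamma$ with a signature $\sigma:E(\Gamma)\to\{\pm1\}$; signed graphs are isomorphic if some isomorphism of underlying graphs preserves all edge signs. For $\mathbf a=(a_1,\dots,a_n)\in\{-1,0,1\}^n$, the signed threshold graph $\mathcal T_{\mathbf a}$ is built by starting from the one-vertex graph $K_1$ and, for $i=1,\dots,n$ in order, adding a new vertex that is isolated if $a_i=0$, joined by positive edges to all existing vertices if $a_i=1$, and joined by negative edges to all existing vertices if $a_i=-1$ (so $\mathcal T_{()}=K_1$). For a finite $C\subseteq\mathbb Z$, a proper $C$-colouring of $\Sigma$ is a map $\kappa:V(\Gamma)\to C$ with $\kappa(v)\ne\sigma(\{v,w\})\kappa(w)$ for every edge $\{v,w\}$. For integers $\lambda\ge\mu\ge0$, a finite $C\subseteq\mathbb Z$ is a $(\lambda,\mu)$-colour set if there are disjoint sets $P,U$ of nonzero integers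 with $-P=P$, $|U|=\mu$, $(-U)\cap U=\varnothing$, and either $\lambda-\mu$ even, $|P|=\lambda-\mu$, $C=P\cup U$, or $\lambda-\mu$ odd, $|P|=\lambda-\mu-1$, $C=P\cup U\cup\{0\}$. $f(\Sigma,\lambda,\mu)$ is the number of proper $C$-colourings for any $(\lambda,\mu)$-colour set $C$ (independent of $C$). $\mathsf E(\Sigma,x,y),\mathsf O(\Sigma,x,y)\in\mathbb Z[x,y]$ are the unique polynomials with $f(\Sigma,\lambda,\mu)=\mathsf E(\Sigma,\lambda,\mu)$ for all integers $\lambda\ge\mu\ge0$ with $\lambda-\mu$ even and $f(\Sigma,\lambda,\mu)=\mathsf O(\Sigma,\lambda,\mu)$ whenever $\lambda-\mu$ is odd. *)

(* Defs.v *)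
From HB Require Import structures.
From mathcomp Require Import all_boot all_order all_algebra.
From mathcomp Require Import finmap.
From Stdlib Require Import ClassicalEpsilon.

Set Implicit Arguments.
Unset Strict Implicit.
Unset Printing Implicit Defensive.

Import Order.TTheory GRing.Theory Num.Theory.
Local Open Scope ring_scope.

(* [sgn v w] is the sign of the edge {v, w}; its value on non-adjacent pairs
   carries no information and is never used. *)
Record signed_graph := SignedGraph {
  vertex :> finType;
  adj : rel vertex;
  sgn : vertex -> vertex -> int;
  adj_sym : symmetric adj;
  adj_irr : irreflexive adj;
  sgn_sym : forall v w, adj v w -> sgn v w = sgn w v;
  sgn_pm1 : forall v w, adj v w -> sgn v w \in [:: 1; -1]
}.

Definition sg_isomorphic (G H : signed_graph) : Prop :=
  exists phi : G -> H,
    [/\ bijective phi,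
        (forall v w : G, adj (phi v) (phi w) = adj v w) &
        (forall v w : G, adj v w -> sgn (phi v) (phi w) = sgn v w)].

Section OneVertex.

Definition K1_adj : rel unit := fun _ _ => false.
Definition K1_sgn : unit -> unit -> int := fun _ _ => 1.

Lemma K1_adj_sym : symmetric K1_adj. Proof. by []. Qed.
Lemma K1_adj_irr : irreflexive K1_adj. Proof. by []. Qed.
Lemma K1_sgn_sym v w : K1_adj v w -> K1_sgn v w = K1_sgn w v.
Proof. by []. Qed.
Lemma K1_sgn_pm1 v w : K1_adj v w -> K1_sgn v w \in [:: 1; -1].
Proof. by []. Qed.

Definition K1 : signed_graph :=
  SignedGraph K1_adj_sym K1_adj_irr K1_sgn_sym K1_sgn_pm1.

End OneVertex.

(* The new vertex is [None]. It is joined to all old vertices by edges of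
   sign c when c = 1 or c = -1, and is isolated otherwise; only
   c = -1, 0, 1 is meaningful. *)
Section AddVertex.

Variables (G : signed_graph) (c : int).

Definition add_adj : rel (option G) := fun v w =>
  match v, w with
  | Some v', Some w' => adj v' w'
  | None, None => false
  | _, _ => c \in [:: 1; -1]
  end.

Definition add_sgn (v w : option G) : int :=
  match v, w with
  | Some v', Some w' => sgn v' w'
  | _, _ => c
  end.

Lemma add_adj_sym : symmetric add_adj.
Proof. by case=> [v|] [w|] //=; apply: adj_sym. Qed.
Lemma add_adj_irr : irreflexive add_adj.
Proof. by case=> [v|] //=; apply: adj_irr. Qed.
Lemma add_sgn_sym v w : add_adj v w -> add_sgn v w = add_sgn w v.
Proof. by case: v w => [v|] [w|] //=; apply: sgn_sym. Qed.
Lemma add_sgn_pm1 v w : add_adj v w -> add_sgn v w \in [:: 1; -1].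
Proof. by case: v w => [v|] [w|] //=; apply: sgn_pm1. Qed.

Definition add_vertex : signed_graph :=
  SignedGraph add_adj_sym add_adj_irr add_sgn_sym add_sgn_pm1.

End AddVertex.

Definition threshold (a : seq int) : signed_graph := foldl add_vertex K1 a.

Definition proper_colouring (G : signed_graph) (C : {fset int})
    (k : {ffun G -> C}) : bool :=
  [forall v : G, forall w : G,
     adj v w ==> (val (k v) != sgn v w * val (k w))].

Definition num_colourings (G : signed_graph) (C : {fset int}) : nat :=
  #|[set k : {ffun G -> C} | proper_colouring k]|.

Definition fset_opp (A : {fset int}) : {fset int} := [fset - x | x in A]%fset.

Definition colour_set (l m : nat) (C : {fset int}) : Prop :=
  (m <= l)%N /\
  exists P U : {fset int},
    [/\ 0 \notin P, 0 \notin U & [disjoint P & U]%fset] /\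
    [/\ fset_opp P = P, #|` U| = m & [disjoint fset_opp U & U]%fset] /\
    ([/\ ~~ odd (l - m), #|` P| = (l - m)%N & C = (P `|` U)%fset] \/
     [/\ odd (l - m), #|` P| = (l - m - 1)%N & C = (P `|` U `|` [fset 0])%fset]).

(* Z[x, y] is {poly {poly int}}, with p.[x, y] substituting x for the outer
   and y for the inner variable. *)
Definition is_Epoly (G : signed_graph) (p : {poly {poly int}}) : Prop :=
  forall (l m : nat) (C : {fset int}),
    (m <= l)%N -> ~~ odd (l - m) -> colour_set l m C ->
    (num_colourings G C)%:Z = p.[l%:Z, m%:Z].

Definition is_Opoly (G : signed_graph) (p : {poly {poly int}}) : Prop :=
  forall (l m : nat) (C : {fset int}),
    (m <= l)%N -> odd (l - m) -> colour_set l m C ->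
    (num_colourings G C)%:Z = p.[l%:Z, m%:Z].

(* "The" polynomials satisfying these specifications: epsilon picks a
   polynomial satisfying its predicate whenever one exists, and here exactly
   one does. *)
Definition Epoly (G : signed_graph) : {poly {poly int}} :=
  epsilon (inhabits 0) (is_Epoly G).

Definition Opoly (G : signed_graph) : {poly {poly int}} :=
  epsilon (inhabits 0) (is_Opoly G).

(* Main.v *)
(** If [C] contains [l] nonzero colours, [m] of which have their negative
    outside [C], then colouring the last vertex of a threshold graph first
    gives a recursion in [(l, m)] for the number of colourings. On the diagonal
    [l = m] only positive edges matter, and the recursion is the one for the
    chromatic polynomial of the threshold graph in which [-1] is replaced by
    [0]. That polynomial has a multiple root at [0] exactly when the last letter
    is not [1], so all the positions of the letter [1] can be read off [E].
    A word over [{0, 1}] and one over [{1, -1}] with the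
    same positions of [1] are told apart off the diagonal: there negative edges
    strictly reduce the number of colourings. *)
Require Import Defs.
From mathcomp Require Import all_boot all_order all_algebra.
From mathcomp Require Import finmap zify ring.
From Stdlib Require Import ClassicalEpsilon FunctionalExtensionality.
From Stdlib Require Import PropExtensionality.

Set Implicit Arguments.
Unset Strict Implicit.
Unset Printing Implicit Defensive.

Import Order.TTheory GRing.Theory Num.Theory.
Local Open Scope ring_scope.

(** * Isomorphism invariance *)

Lemma num_colourings_iso (G H : signed_graph) (C : {fset int}) :
  sg_isomorphic G H -> num_colourings G C = num_colourings H C.
Proof.
case=> phi [phi_bij phi_adj phi_sgn]; have [psi phiK psiK] := phi_bij.
pose f (k : {ffun H -> C}) : {ffun G -> C} := [ffun v => k (phi v)].
have f_bij : bijective f.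
  exists (fun k : {ffun G -> C} => [ffun w => k (psi w)]) => k.
    by apply/ffunP => w; rewrite !ffunE psiK.
  by apply/ffunP => v; rewrite !ffunE phiK.
rewrite /num_colourings -(on_card_preimset (f := f)); last first.
  by apply: onW_bij.
apply: eq_card => k; rewrite !inE /proper_colouring.
apply/forallP/forallP => k_proper.
  move=> v; apply/forallP => w; apply/implyP => vw.
  have := k_proper (psi v) => /forallP /(_ (psi w)).
  have vw' : adj (psi v) (psi w) by rewrite -phi_adj !psiK.
  by rewrite !ffunE vw' !psiK /= -(phi_sgn _ _ vw') !psiK.
move=> v; apply/forallP => w; apply/implyP => vw.
have := k_proper (phi v) => /forallP /(_ (phi w)).
by rewrite !ffunE phi_adj vw /= phi_sgn.
Qed.

(** Equal colouring counts make the two predicates equal by extensionality, so [epsilon] picks the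
    same polynomial for both. *)
Lemma Epoly_iso (G H : signed_graph) : sg_isomorphic G H -> Epoly G = Epoly H.
Proof.
move=> iso; rewrite /Epoly; congr epsilon.
apply: functional_extensionality => p; apply: propositional_extensionality.
by split=> pP l m C lm odd_lm C_col;
   rewrite -(pP l m C lm odd_lm C_col) (num_colourings_iso C iso).
Qed.

Lemma Opoly_iso (G H : signed_graph) : sg_isomorphic G H -> Opoly G = Opoly H.
Proof.
move=> iso; rewrite /Opoly; congr epsilon.
apply: functional_extensionality => p; apply: propositional_extensionality.
by split=> pP l m C lm odd_lm C_col;
   rewrite -(pP l m C lm odd_lm C_col) (num_colourings_iso C iso).
Qed.

(** * Colourings of a graph with one more vertex *)

(** Places colourings with fewer colours in the function type of [C], where forbidding a colour is a
    condition on [C]-colourings. *)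
Lemma num_colourings_sub (G : signed_graph) (C D : {fset int}) :
  (D `<=` C)%fset ->
  num_colourings G D =
  #|[set k : {ffun G -> C} |
       proper_colouring k && [forall v, val (k v) \in D]]|.
Proof.
move=> sDC.
pose f (k : {ffun G -> D}) : {ffun G -> C} := [ffun v => fincl sDC (k v)].
have f_inj : injective f.
  move=> k k' /ffunP kk'; apply/ffunP => v; apply: val_inj.
  by have /(congr1 val) := kk' v; rewrite !ffunE.
rewrite /num_colourings -(card_imset _ f_inj); apply: eq_card => k.
rewrite inE; apply/imsetP/andP.
  case=> k'; rewrite inE => k'_proper ->; split; last first.
    by apply/forallP => v; rewrite ffunE /= fsvalP.
  apply/forallP => v; apply/forallP => w; rewrite !ffunE /=.
  by have /forallP/(_ v)/forallP/(_ w) := k'_proper.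
case=> k_proper /forallP kD.
exists [ffun v => FSetSub (kD v)].
  rewrite inE; apply/forallP => v; apply/forallP => w; rewrite !ffunE /=.
  by have /forallP/(_ v)/forallP/(_ w) := k_proper.
by apply/ffunP => v; apply: val_inj; rewrite !ffunE.
Qed.

Lemma num_colourings_add_vertex (G : signed_graph) (c : int) (C : {fset int}) :
  num_colourings (add_vertex G c) C =
  (\sum_(x : C) #|[set k : {ffun G -> C} | proper_colouring k &&
     [forall v, ((c \in [:: 1; -1]) ==> (val (k v) != c * val x))%R]]|)%N.
Proof.
rewrite /num_colourings -sum1_card.
rewrite (partition_big (fun k : {ffun add_vertex G c -> C} => k None) xpredT) //=.
apply: eq_bigr => x _; rewrite sum1_card.
pose f (k : {ffun G -> C}) : {ffun add_vertex G c -> C} :=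
  [ffun v => if v is Some v' then k v' else x].
have f_inj : injective f.
  move=> k k' /ffunP kk'; apply/ffunP => v.
  by have := kk' (Some v); rewrite !ffunE.
rewrite -(card_imset _ f_inj); apply: eq_card => k.
rewrite unfold_in /= inE; apply/andP/imsetP.
  case=> k_proper /eqP kNone; exists [ffun v => k (Some v)]; last first.
    by apply/ffunP => -[v|]; rewrite !ffunE.
  rewrite inE; apply/andP; split.
    apply/forallP => v; apply/forallP => w; rewrite !ffunE.
    by have /forallP/(_ (Some v))/forallP/(_ (Some w)) := k_proper.
  apply/forallP => v; rewrite !ffunE -kNone.
  by have /forallP/(_ (Some v))/forallP/(_ None) := k_proper.
case=> k'; rewrite inE => /andP[k'_proper /forallP k'x] ->.
split; last by rewrite ffunE.
apply/forallP => -[v|]; apply/forallP => -[w|]; rewrite !ffunE //=.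
- by have /forallP/(_ v)/forallP/(_ w) := k'_proper.
(* The edge seen from [None] imposes the same constraint, because [c * c = 1]. *)
- apply/implyP => c1; have := k'x w; rewrite c1 /=; apply: contra => /eqP ->.
  by rewrite mulrA; move: c1; rewrite !inE => /orP[] /eqP ->;
     rewrite ?mulrNN ?mulN1r ?mul1r ?opprK.
Qed.

Lemma num_colourings_isolated (G : signed_graph) (C : {fset int}) :
  num_colourings (add_vertex G 0) C = (#|` C| * num_colourings G C)%N.
Proof.
rewrite num_colourings_add_vertex cardfE -sum_nat_const.
apply: eq_bigr => x _; apply: eq_card => k; rewrite !inE.
by rewrite andb_idr // => _; apply/forallP.
Qed.

Lemma num_colourings_join (G : signed_graph) (c : int) (C : {fset int}) :
  c \in [:: 1; -1] ->
  num_colourings (add_vertex G c) C =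
  (\sum_(x <- C) num_colourings G (C `\ (c * x)%R)%fset)%N.
Proof.
move=> c1; rewrite num_colourings_add_vertex big_seq_fsetE /=.
apply: eq_bigr => x _.
rewrite (num_colourings_sub G (fsubD1set C (c * val x))).
apply: eq_card => k; rewrite 2!in_set c1 /=; congr andb.
by apply: eq_forallb => v; rewrite in_fsetD1 fsvalP andbT.
Qed.

(** * Counting recursion *)

(** Recovers the part [U] of a colour set, since [P] is closed under negation. *)
Definition unpaired (C : {fset int}) : {fset int} :=
  [fset x in C | - x \notin C]%fset.

(* A [(l, m)]-colour set with [l - m] even, described without choosing [P, U]. *)
Definition even_colour_set (l m : nat) (C : {fset int}) : Prop :=
  [/\ 0 \notin C, #|` C| = l & #|` unpaired C| = m].

Lemma mem_unpaired C x : (x \in unpaired C) = (x \in C) && (- x \notin C).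
Proof. by rewrite !inE. Qed.

Lemma mem_fset_opp (A : {fset int}) x : (x \in fset_opp A) = (- x \in A).
Proof.
apply/imfsetP/idP => /= [[y yA ->]|xA]; first by rewrite opprK.
by exists (- x); rewrite ?opprK.
Qed.

Lemma colour_set_even l m C : ~~ odd (l - m) -> colour_set l m C ->
  even_colour_set l m C.
Proof.
move=> even_lm [le_ml [P [U [[P0 U0 PU] [[PN Um UN]]]]]].
case=> [[_ Pc ->]|[]]; last by rewrite (negPf even_lm).
have PE x : (- x \in P) = (x \in P) by rewrite -mem_fset_opp PN.
split; first by rewrite inE negb_or P0.
- have := cardfsUI P U.
  by rewrite (eqP (PU : (_ == _))) cardfs0 addn0 Um Pc => ->; rewrite subnK.
rewrite -Um; congr (#|` _|); apply/fsetP => x.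
rewrite mem_unpaired !inE PE.
have [xU|xU] := boolP (x \in U); last by case: (x \in P).
have xP : x \notin P by apply/negP => xP; move/fdisjointP: PU => /(_ x xP); rewrite xU.
rewrite (negPf xP) /=; move/fdisjointP: UN => /(_ (- x)).
by rewrite mem_fset_opp opprK; apply.
Qed.

Lemma even_colour_set_del_unpaired l m C x : even_colour_set l m C ->
  x \in unpaired C -> even_colour_set l.-1 m.-1 (C `\ x)%fset.
Proof.
move=> [C0 Cl Cm] xU; have := xU; rewrite mem_unpaired => /andP[xC xNC].
split; first by rewrite !inE negb_and C0 orbT.
- by rewrite -Cl (cardfsD1 x C) xC.
rewrite -Cm (cardfsD1 x (unpaired C)) xU /=; congr (#|` _|).
apply/fsetP => y; rewrite in_fsetD1 !mem_unpaired !in_fsetD1.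
case: (eqVneq y x) => //= yx.
case: (eqVneq (- y) x) => //= yx'.
by move: xNC; rewrite -yx' opprK => /negPf ->.
Qed.

(** Deleting [x] leaves [- x] without a partner, hence newly unpaired. As [0] is not a colour, [x]
    and [- x] differ, and [l - m] drops by two and stays even. *)
Lemma even_colour_set_del_paired l m C x : even_colour_set l m C ->
  x \in C -> - x \in C -> even_colour_set l.-1 m.+1 (C `\ x)%fset.
Proof.
move=> [C0 Cl Cm] xC xNC; split; first by rewrite !inE negb_and C0 orbT.
  by rewrite -Cl (cardfsD1 x C) xC.
have x0 : x != 0 by apply: contraNneq C0 => <-.
have xNU : - x \notin unpaired C by rewrite mem_unpaired opprK xC andbF.
rewrite -Cm -[RHS]add1n -[1%N]/(nat_of_bool true) -xNU -cardfsU1; congr (#|` _|).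
apply/fsetP => y; rewrite in_fset1U !mem_unpaired !in_fsetD1 eqr_oppLR.
have [->|yNx] := eqVneq y (- x); first by rewrite xNC andbT /=; lia.
have [->|//] := eqVneq y x.
by rewrite xNC xC.
Qed.

Lemma sum_const_fset (A : {fset int}) (F : int -> nat) (c : nat) :
  {in A, forall x, F x = c} -> (\sum_(x <- A) F x = #|` A| * c)%N.
Proof.
move=> Fc; rewrite big_seq (eq_bigr (fun=> c)) // -big_seq.
by rewrite big_const_seq count_predT iter_addn_0 mulnC.
Qed.

(** The summands belong to the [m] unpaired and the [l - m] paired colours [x] of the new vertex. A
    joined vertex deletes [c * x] from the colours of the rest; for [c = -1] and [x] unpaired, this
    colour is absent and nothing is lost. *)
Definition count_step (F : nat -> nat -> nat) (c : int) (l m : nat) : nat :=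
  if c == 1 then (m * F l.-1 m.-1 + (l - m) * F l.-1 m.+1)%N
  else if c == -1 then (m * F l m + (l - m) * F l.-1 m.+1)%N
  else (l * F l m)%N.

Definition count_threshold (a : seq int) : nat -> nat -> nat :=
  foldl count_step (fun l _ => l) a.

Lemma count_threshold_rcons a c l m :
  count_threshold (rcons a c) l m = count_step (count_threshold a) c l m.
Proof. by rewrite /count_threshold foldl_rcons. Qed.

Lemma num_colourings_K1 (C : {fset int}) : num_colourings K1 C = #|` C|.
Proof.
rewrite /num_colourings (_ : [set _ | _] = setT).
  by rewrite cardsT card_ffun card_unit expn1 cardfE.
by apply/setP => k; rewrite !inE; apply/forallP => v; apply/forallP.
Qed.

Lemma num_colourings_threshold a l m C :
  all (mem [:: 0; 1; -1]) a -> even_colour_set l m C ->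
  num_colourings (threshold a) C = count_threshold a l m.
Proof.
elim/last_ind: a l m C => [|a c IH] l m C.
  by move=> _ [_ <- _]; exact: num_colourings_K1.
rewrite all_rcons => /andP[c01 a01] Cc; have [C0 Cl Cm] := Cc.
(* Summing the constant 1 over the splitting of [C] into unpaired and paired colours counts the
   latter. *)
have pairedE : #|` [fset x in C | ~~ (- x \notin C)]%fset| = (l - m)%N.
  have := @big_fsetID _ 0%N addn _ (fun x => - x \notin C) C (fun=> 1%N).
  rewrite !(@sum_const_fset _ (fun=> 1%N) 1%N) // !muln1.
  by rewrite Cl -/(unpaired C) Cm => ->; rewrite addKn.
rewrite count_threshold_rcons /threshold foldl_rcons -/(threshold a) /count_step.
have IHpaired x : x \in C -> - x \in C ->
    num_colourings (threshold a) (C `\ x)%fset = count_threshold a l.-1 m.+1.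
  by move=> xC xNC; apply: IH => //; apply: even_colour_set_del_paired.
move: c01; rewrite !inE => /or3P[] /eqP-> /=.
- by rewrite num_colourings_isolated Cl (IH _ _ _ a01 Cc).
- rewrite num_colourings_join // (big_fsetID _ (fun x => - x \notin C)) /=.
  rewrite (@sum_const_fset _ _ (count_threshold a l.-1 m.-1)); last first.
    move=> x; rewrite -/(unpaired C) => xU; rewrite mul1r; apply: IH => //.
    exact: even_colour_set_del_unpaired.
  rewrite (@sum_const_fset _ _ (count_threshold a l.-1 m.+1)); last first.
    by move=> x; rewrite !inE negbK /= mul1r => /andP[]; apply: IHpaired.
  by rewrite pairedE -/(unpaired C) Cm.
- rewrite num_colourings_join // (big_fsetID _ (fun x => - x \notin C)) /=.
  rewrite (@sum_const_fset _ _ (count_threshold a l m)); last first.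
    move=> x; rewrite -/(unpaired C) mem_unpaired mulN1r => /andP[_ xNC].
    rewrite (_ : (C `\ - x)%fset = C); first exact: IH.
    by apply/fsetDidPl; rewrite fdisjointX1.
  rewrite (@sum_const_fset _ _ (count_threshold a l.-1 m.+1)); last first.
    move=> x; rewrite !inE negbK /= mulN1r => /andP[xC xNC].
    by apply: IHpaired; rewrite ?opprK.
  by rewrite pairedE -/(unpaired C) Cm.
Qed.

Lemma colour_set_exists l m : (m <= l)%N -> ~~ odd (l - m) ->
  exists C, colour_set l m C.
Proof.
move=> le_ml even_lm.
pose s j k := [seq i.+1%:Z | i <- iota j k].
have s_uniq j k : uniq (s j k).
  by rewrite map_inj_uniq ?iota_uniq // => i i' [].
have mem_s j k (x : int) : (x \in s j k) = (j%:Z < x <= (j + k)%:Z).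
  apply/mapP/idP => [[i]|x_bnd]; first by rewrite mem_iota => ? ->; lia.
  by exists `|x|%N.-1; rewrite ?mem_iota; lia.
have mem_sN j k (x : int) : (x \in map -%R (s j k)) = (- x \in s j k).
  by rewrite -{1}(opprK x) mem_map //; apply: oppr_inj.
(* [U] is the interval from 1 to [m], and [P] consists of the integers of absolute value [m + 1] to
   [m + q]. *)
pose q := (l - m)./2.
pose P := [fset x in s m q ++ map -%R (s m q)]%fset.
pose U := [fset x in s 0%N m]%fset.
have PE x : (x \in P) = (m%:Z < `|x| <= (m + q)%:Z).
  by rewrite !inE /= mem_sN !mem_s; lia.
have UE x : (x \in U) = (0 < x <= m%:Z) by rewrite inE mem_s.
exists (P `|` U)%fset; split=> //; exists P, U; split; last split.
- split; rewrite ?PE ?UE //.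
  by apply/fdisjointP => x; rewrite PE UE; lia.
- split; first by apply/fsetP => x; rewrite mem_fset_opp !PE normrN.
    by rewrite card_fseq undup_id // size_map size_iota.
  by apply/fdisjointP => x; rewrite mem_fset_opp !UE; lia.
left; split=> //; rewrite card_fseq undup_id.
  by rewrite size_cat !size_map size_iota addnn /q; lia.
rewrite cat_uniq s_uniq map_inj_uniq ?s_uniq ?andbT /=; last exact: oppr_inj.
by apply/hasPn => x; rewrite mem_sN !mem_s; lia.
Qed.

(** * The polynomial [E] of a threshold graph *)

Lemma horner_map_comp_poly (p : {poly {poly int}}) (r : {poly int}) (x y : int) :
  (map_poly (comp_poly r) p).[x, y] = p.[x, r.[y]].
Proof.
elim/poly_ind: p => [|p c IH]; first by rewrite rmorph0 !horner0.
rewrite rmorphD rmorphM /= map_polyX map_polyC /= !hornerMXaddC.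
by rewrite !hornerD !hornerM IH !hornerC horner_comp.
Qed.

Lemma horner_shift (p : {poly {poly int}}) (i j : int) :
  exists q : {poly {poly int}}, forall x y : int, q.[x, y] = p.[x + i, y + j].
Proof.
exists (map_poly (comp_poly ('X + j%:P)) (p \Po ('X + i%:P%:P))) => x y.
rewrite horner_map_comp_poly horner_comp !hornerD !hornerX !hornerC.
by rewrite polyCD.
Qed.

(** Each step of the recursion is polynomial once predecessors and successors are read as shifts of
    the variables. *)
Lemma count_threshold_poly a : exists p : {poly {poly int}},
  forall l m, (m <= l)%N -> ~~ odd (l - m) ->
    (count_threshold a l m)%:Z = p.[l%:Z, m%:Z].
Proof.
elim/last_ind: a => [|a c [p pE]].
  by exists 'X => l m _ _; rewrite hornerX hornerC.
have [p1 p1E] := horner_shift p (-1) (-1).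
have [p2 p2E] := horner_shift p (-1) 1.
exists (if c == 1 then 'X%:P * p1 + ('X - 'X%:P) * p2
        else if c == -1 then 'X%:P * p + ('X - 'X%:P) * p2 else 'X * p) => l m.
move=> le_ml even_lm; rewrite count_threshold_rcons /count_step.
have paired : ((l - m) * count_threshold a l.-1 m.+1)%N%:Z =
    (l%:Z - m%:Z) * p.[l%:Z + (-1), m%:Z + 1].
  (* For [l = m] the shifted pair leaves the range where [p] is known, but the factor [l - m]
     vanishes; otherwise evenness gives [l - m >= 2]. The factor [m] does the same for [m = 0]
     below. *)
  have [eq_lm|lt_ml] := posnP (l - m)%N.
    by rewrite eq_lm (_ : l = m) ?subrr ?mul0r //; lia.
  rewrite PoszM -subzn // pE; [|lia|lia].
  by congr (_ * horner_eval _ (horner_eval _%:P p)); lia.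
have unpairedE : (m * count_threshold a l.-1 m.-1)%N%:Z =
    m%:Z * p.[l%:Z + (-1), m%:Z + (-1)].
  case: m le_ml even_lm {paired} => [|m] le_ml even_lm; first by rewrite !mul0r.
  rewrite PoszM pE /=; [|lia|lia].
  by congr (_ * horner_eval _ (horner_eval _%:P p)); lia.
case: ifP => _; last case: ifP => _.
- rewrite PoszD paired unpairedE -p1E -p2E.
  by rewrite !(hornerD, hornerN, hornerM, hornerX, hornerC).
- rewrite PoszD paired PoszM pE // -p2E.
  by rewrite !(hornerD, hornerN, hornerM, hornerX, hornerC).
- by rewrite PoszM pE // !(hornerD, hornerN, hornerM, hornerX, hornerC).
Qed.

Lemma is_Epoly_threshold a : all (mem [:: 0; 1; -1]) a ->
  is_Epoly (threshold a) (Epoly (threshold a)).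
Proof.
move=> a01; apply: epsilon_spec; have [p pE] := count_threshold_poly a.
exists p => l m C le_ml even_lm /(colour_set_even even_lm) Cc.
by rewrite (num_colourings_threshold a01 Cc) pE.
Qed.

(** Since a colour set exists for every admissible pair, the polynomial determines all values of the
    recursion there. *)
Lemma Epoly_threshold_count a b l m :
  all (mem [:: 0; 1; -1]) a -> all (mem [:: 0; 1; -1]) b ->
  Epoly (threshold a) = Epoly (threshold b) ->
  (m <= l)%N -> ~~ odd (l - m) ->
  count_threshold a l m = count_threshold b l m.
Proof.
move=> a01 b01 eqE le_ml even_lm; have [C Cc] := colour_set_exists le_ml even_lm.
have Cc' := colour_set_even even_lm Cc; apply: (can_inj absz_nat).
rewrite -(num_colourings_threshold a01 Cc') -(num_colourings_threshold b01 Cc').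
rewrite (is_Epoly_threshold a01 le_ml even_lm Cc) eqE.
by rewrite (is_Epoly_threshold b01 le_ml even_lm Cc).
Qed.

(** * Positive edges *)

(* The number of colourings of the positive subgraph of [threshold a]. *)
Definition pos_count (a : seq int) : nat -> nat :=
  foldl (fun F c l => (l * F (if (c == 1)%R then l.-1 else l))%N) id a.

(** The chromatic polynomial of the positive subgraph: a dominating vertex turns [p(x)] into
    [x p(x - 1)], an isolated one into [x p(x)]. *)
Definition pos_chrom (a : seq int) : {poly int} :=
  foldl (fun p c => 'X * (if c == 1 then p \Po ('X - 1) else p)) 'X a.

Lemma pos_count_rcons a c l :
  pos_count (rcons a c) l = (l * pos_count a (if (c == 1)%R then l.-1 else l))%N.
Proof. by rewrite /pos_count foldl_rcons. Qed.

Lemma pos_chrom_rcons a c :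
  pos_chrom (rcons a c) =
  'X * (if c == 1 then pos_chrom a \Po ('X - 1) else pos_chrom a).
Proof. by rewrite /pos_chrom foldl_rcons. Qed.

(** Without paired colours, a vertex joined by negative edges forbids nothing and acts as an
    isolated one. *)
Lemma count_threshold_diag a l : count_threshold a l l = pos_count a l.
Proof.
elim/last_ind: a l => [//|a c IH] l.
rewrite count_threshold_rcons /count_step pos_count_rcons subnn !mul0n !addn0 !IH.
by do 2?case: ifP.
Qed.

Lemma horner_pos_chrom a l : (pos_chrom a).[l%:Z] = (pos_count a l)%:Z.
Proof.
elim/last_ind: a l => [|a c IH] l; first by rewrite hornerX.
rewrite pos_chrom_rcons pos_count_rcons hornerM hornerX PoszM.
case: ifP => _; last by rewrite IH.
(* At [l = 0] the truncated predecessor is not [l - 1], but both sides carry the factor [l]. *)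
case: l => [|l]; first by rewrite !mul0r.
rewrite horner_comp hornerD hornerX hornerN hornerC -IH /=.
by rewrite (_ : l.+1%:Z - 1 = l) //; lia.
Qed.

(** Each letter contributes a factor [- x] and evaluates the rest at [- x] or [- x - 1], again
    negative, so the sign alternates with the length. *)
Lemma pos_chrom_neg a (x : int) :
  0 < x -> 0 < (-1) ^+ (size a).+1 * (pos_chrom a).[- x].
Proof.
elim/last_ind: a x => [|a c IH] x x0.
  by rewrite hornerX expr1 mulN1r opprK.
rewrite size_rcons exprS pos_chrom_rcons hornerM hornerX.
set y := _.[- x]; have -> : -1 * (-1) ^+ (size a).+1 * (- x * y) =
  x * ((-1) ^+ (size a).+1 * y) by ring.
rewrite mulr_gt0 // /y; case: ifP => _; last exact: IH.
rewrite horner_comp hornerD hornerX hornerN hornerC -opprD.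
by apply: IH; lia.
Qed.

Lemma pos_chrom_at0 a : (pos_chrom a).[0] = 0.
Proof.
case/lastP: a => [|a c]; first by rewrite hornerX.
by rewrite pos_chrom_rcons hornerM hornerX mul0r.
Qed.

(** At 0 the shifted polynomial takes a nonzero value at [-1], whereas the other one vanishes. This
    detects whether the last letter is [1]. *)
Lemma pos_chrom_shift_neq a b : pos_chrom a \Po ('X - 1) <> pos_chrom b.
Proof.
move=> /(congr1 (horner^~ 0)) /=.
rewrite pos_chrom_at0 horner_comp hornerD hornerX hornerN hornerC add0r => E.
by have := @pos_chrom_neg a 1 isT; rewrite E mulr0 ltxx.
Qed.

Lemma pos_chrom_inj a b : size a = size b -> pos_chrom a = pos_chrom b ->
  [seq c == 1 | c <- a] = [seq c == 1 | c <- b].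
Proof.
elim/last_ind: a b => [|a c IH] b; case/lastP: b => [|b d] //;
  rewrite ?size_rcons // => -[eq_sz].
rewrite !pos_chrom_rcons !map_rcons => /(mulfI (negbT (polyX_eq0 _))).
case: (c == 1); case: (d == 1) => E.
- congr rcons; apply: IH => //.
  (* Composing with ['X + 1] undoes the shift on both sides. *)
  move/(congr1 (fun p => p \Po ('X + 1))): E.
  by rewrite -!comp_polyA comp_polyB comp_polyX comp_polyC addrK !comp_polyXr.
- by case: (pos_chrom_shift_neq E).
- by case: (pos_chrom_shift_neq (esym E)).
- by congr rcons; apply: IH.
Qed.

Lemma poly_int_eq_nat (p q : {poly int}) :
  (forall l : nat, p.[l%:Z] = q.[l%:Z]) -> p = q.
Proof.
move=> pq; apply/eqP; rewrite -subr_eq0; apply/negPn/negP => pq0.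
have := @max_poly_roots _ _ [seq i%:Z | i <- iota 0 (size (p - q))] pq0.
rewrite size_map size_iota ltnn => H; suff: false by []; apply: H.
  by apply/allP => _ /mapP[i _ ->]; rewrite rootE hornerD hornerN pq subrr.
by rewrite map_inj_uniq ?iota_uniq // => i j [].
Qed.

Lemma pos_count_inj a b : size a = size b -> pos_count a =1 pos_count b ->
  [seq c == 1 | c <- a] = [seq c == 1 | c <- b].
Proof.
move=> eq_sz ab; apply: pos_chrom_inj => //; apply: poly_int_eq_nat => l.
by rewrite !horner_pos_chrom ab.
Qed.

(** * Negative edges *)

Lemma pos_count_mono a l l' : (l <= l')%N -> (pos_count a l <= pos_count a l')%N.
Proof.
elim/last_ind: a l l' => [//|a c IH] l l' le_ll'.
by rewrite !pos_count_rcons leq_mul //; apply: IH; case: ifP => _; lia.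
Qed.

(** Each letter [1] lowers the argument by one; the bound keeps it at least the length of the
    remaining word. *)
Lemma pos_count_lt a l : (size a <= l)%N -> (pos_count a l < pos_count a l.+1)%N.
Proof.
elim/last_ind: a l => [//|a c IH] l; rewrite size_rcons => lt_al.
rewrite !pos_count_rcons ltn_mul //.
by case: ifP => _; [case: l lt_al => // l lt_al|]; apply: IH; lia.
Qed.

Lemma count_threshold_01 (a : seq int) (l m : nat) : all (mem [:: 0; 1]) a ->
  (m <= l)%N -> ~~ odd (l - m) -> count_threshold a l m = pos_count a l.
Proof.
elim/last_ind: a l m => [//|a c IH] l m; rewrite all_rcons => /andP[c01 a01].
move=> le_ml even_lm; rewrite count_threshold_rcons /count_step pos_count_rcons.
move: c01; rewrite !inE => /orP[] /eqP -> /=; first by rewrite IH.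
have -> : (m * count_threshold a l.-1 m.-1 = m * pos_count a l.-1)%N.
  by case: m le_ml even_lm => // m ? ?; rewrite IH //; lia.
have -> : ((l - m) * count_threshold a l.-1 m.+1 = (l - m) * pos_count a l.-1)%N.
  by have [->//|?] := posnP (l - m)%N; rewrite IH //; lia.
by rewrite -mulnDl subnKC.
Qed.

Lemma count_threshold_le a l m : (m <= l)%N -> ~~ odd (l - m) ->
  (count_threshold a l m <= pos_count a l)%N.
Proof.
elim/last_ind: a l m => [//|a c IH] l m le_ml even_lm.
rewrite count_threshold_rcons /count_step pos_count_rcons.
have paired : ((l - m) * count_threshold a l.-1 m.+1 <= (l - m) * pos_count a l.-1)%N.
  by have [->//|?] := posnP (l - m)%N; rewrite leq_mul // IH //; lia.
case: ifP => _.
  rewrite -[X in (_ <= X * _)%N](subnKC le_ml) mulnDl leq_add //.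
  by case: m le_ml even_lm {paired} => // m ? ?; rewrite leq_mul // IH //; lia.
case: ifP => _; last by rewrite leq_mul // IH.
rewrite -[X in (_ <= X * _)%N](subnKC le_ml) mulnDl leq_add //; first by rewrite leq_mul ?IH.
(* For [c = -1] the positive count keeps the argument [l], so monotonicity bridges [l.-1] and
   [l]. *)
by apply: leq_trans paired _; rewrite leq_mul // pos_count_mono // leq_pred.
Qed.

(** A letter reduces the gap [l - m] by at most two, so a gap of twice the length leaves paired
    colours available when the letter [-1] is reached. *)
Lemma count_threshold_lt (a : seq int) (l m : nat) :
  all (mem [:: 1; -1]) a -> -1 \in a ->
  (m + (size a).*2 <= l)%N -> ~~ odd (l - m) ->
  (count_threshold a l m < pos_count a l)%N.
Proof.
elim/last_ind: a l m => [//|a c IH] l m; rewrite all_rcons => /andP[c1 a1].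
rewrite mem_rcons in_cons size_rcons => ca le_l even_lm.
have le_ml : (m <= l)%N by lia.
rewrite count_threshold_rcons /count_step pos_count_rcons.
rewrite -[X in (_ < X * _)%N](subnKC le_ml) mulnDl.
move: c1 ca; rewrite !inE => /orP[] /eqP -> /= Na.
  (* A last letter [1] passes strictness on from the shorter word through the paired summand. *)
  rewrite -addnS leq_add //; last by rewrite ltn_mul2l IH //; lia.
  case: m le_l even_lm le_ml => // m ? ? ?.
  by rewrite leq_mul // count_threshold_le //; lia.
(* A last letter [-1] creates strictness: its paired summand is bounded by [pos_count] at [l.-1],
   strictly below its value at [l]. *)
rewrite -addnS leq_add //; first by rewrite leq_mul ?count_threshold_le.
rewrite ltn_mul2l; apply/andP; split; first lia.
case: l le_l even_lm le_ml => [|l] ? ? ?; first lia.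
apply: (@leq_ltn_trans (pos_count a l)); last by apply: pos_count_lt; lia.
by apply: count_threshold_le => /=; lia.
Qed.

(** The counts of [a] do not depend on [m], whereas a letter [-1] would make those of [b] strictly
    smaller at [m = 0] than on the diagonal. *)
Lemma count_threshold_separates (a b : seq int) : size a = size b ->
  all (mem [:: 0; 1]) a -> all (mem [:: 1; -1]) b ->
  (forall l m, (m <= l)%N -> ~~ odd (l - m) ->
     count_threshold a l m = count_threshold b l m) ->
  -1 \notin b.
Proof.
move=> eq_sz a01 b1 ab; apply/negP => Nb.
set l := (size b).*2; have even_l : ~~ odd (l - 0) by rewrite subn0 odd_double.
have := count_threshold_lt b1 Nb (leqnn _) even_l.
rewrite -ab // count_threshold_01 // -[pos_count b _]count_threshold_diag.
by rewrite -ab ?subnn // count_threshold_diag ltnn.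
Qed.

(** * Recovering the word from its counts *)

Lemma eq_seq_of_mask (s : seq int) (a b : seq int) :
  {in s &, injective (fun c : int => c == 1)} ->
  all (mem s) a -> all (mem s) b ->
  [seq c == 1 | c <- a] = [seq c == 1 | c <- b] -> a = b.
Proof.
move=> s_inj; elim: a b => [|c a IH] [|d b] //= /andP[cs a_s] /andP[ds b_s].
by move=> [/(s_inj _ _ cs ds) -> /(IH _ a_s b_s) ->].
Qed.

(** The diagonal gives the positions of [1]. For words over different alphabets, separation rules
    out [-1], so both lie over 0 and 1. *)
Lemma count_threshold_inj (a b : seq int) : size a = size b ->
  all (mem [:: 0; 1]) a \/ all (mem [:: 1; -1]) a ->
  all (mem [:: 0; 1]) b \/ all (mem [:: 1; -1]) b ->
  (forall l m, (m <= l)%N -> ~~ odd (l - m) ->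
     count_threshold a l m = count_threshold b l m) ->
  a = b.
Proof.
move=> eq_sz.
have inj01 : {in [:: 0; 1] &, injective (fun c : int => c == 1)}.
  by move=> c d; rewrite !inE => /orP[]/eqP-> /orP[]/eqP->.
have inj1 : {in [:: 1; -1] &, injective (fun c : int => c == 1)}.
  by move=> c d; rewrite !inE => /orP[]/eqP-> /orP[]/eqP->.
have to01 c : all (mem [:: 1; -1]) c -> -1 \notin c -> all (mem [:: 0; 1]) c.
  move=> /allP c1 Nc; apply/allP => x xc; have := c1 x xc; rewrite !inE.
  by case/orP => /eqP xE; rewrite xE ?eqxx ?orbT // -xE xc in Nc *.
move=> ha hb ab.
have mask : [seq c == 1 | c <- a] = [seq c == 1 | c <- b].
  apply: pos_count_inj => // l.
  by rewrite -!count_threshold_diag ab // subnn.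
case: ha hb => [a01|a1] [b01|b1].
- exact: eq_seq_of_mask inj01 a01 b01 mask.
- apply: (eq_seq_of_mask inj01 a01 _ mask); apply: to01 => //.
  exact: (count_threshold_separates eq_sz a01 b1 ab).
- apply: (eq_seq_of_mask inj01 _ b01 mask); apply: to01 => //.
  by apply: (count_threshold_separates (esym eq_sz) b01 a1) => l m ? ?; rewrite ab.
- exact: eq_seq_of_mask inj1 a1 b1 mask.
Qed.

Theorem theorem4p14 (n : nat) (a b : n.-tuple int)
  (ha : (forall i, tnth a i \in [:: 0; 1]) \/ (forall i, tnth a i \in [:: 1; -1]))
  (hb : (forall i, tnth b i \in [:: 0; 1]) \/ (forall i, tnth b i \in [:: 1; -1])) :
  [<-> a = b;
       sg_isomorphic (threshold a) (threshold b);
       Epoly (threshold a) = Epoly (threshold b) /\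
       Opoly (threshold a) = Opoly (threshold b);
       Epoly (threshold a) = Epoly (threshold b)].
Proof.
have all_words (c : n.-tuple int) : (forall i, tnth c i \in [:: 0; 1]) \/
    (forall i, tnth c i \in [:: 1; -1]) ->
    all (mem [:: 0; 1]) c \/ all (mem [:: 1; -1]) c.
  by case=> h; [left|right]; apply/all_tnthP.
have letters (c : seq int) : all (mem [:: 0; 1]) c \/ all (mem [:: 1; -1]) c ->
    all (mem [:: 0; 1; -1]) c.
  by case; apply: sub_all => x; rewrite !inE => /orP[] ->; rewrite ?orbT.
move/all_words in ha; move/all_words in hb.
tfae.
- by move=> ->; exists id; split=> //; exists id.
- by move=> iso; rewrite (Epoly_iso iso) (Opoly_iso iso).
- by case.
- move=> eqE; apply: val_inj; apply: count_threshold_inj => //=.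
    by rewrite !size_tuple.
  by move=> l m; apply: Epoly_threshold_count => //; apply: letters.
Qed.
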